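(* For every integer $d \ge 1$ there exists a constant $C>1$ such that, for every operator norm $\|\cdot\|$ on $M(d)$ induced by a norm on $\mathbb{C}^d$ and every $d$ matrices $A_1,\ldots,A_d \in M(d)$, we have $$\| P(A_1, \ldots, A_d) \| \le C \, \| \Sigma \|^{d-1} \max_{1 \le j \le d} \rho(\Sigma^j)^{1/j}, \qquad \text{where } \Sigma = \{ A_1, \ldots, A_d \}.$$
   Context: $M(d)$ is the space of $d\times d$ complex matrices. $P(A_1,\ldots,A_d)=\sum_{\sigma \in S_d} A_{\sigma(1)} \cdots A_{\sigma(d)}$, where $S_d$ is the set of permutations of $\{1,\ldots,d\}$. For $A\in M(d)$, $\rho(A)$ is the spectral radius of $A$. The operator norm induced by a norm $\|\cdot\|$ on $\mathbb{C}^d$ is $\|A\| = \sup\{\|Av\| : \|v\|=1\}$. For a non-empty bounded set $\Sigma\subset M(d)$, $\|\Sigma\| = \sup_{A\in\Sigma}\|A\|$ and $\rho(\Sigma)=\sup_{A\in\Sigma}\rho(A)$; for an integer $n\ge 1$, $\Sigma^n$ is the set of all products $B_1\cdots B_n$ with all $B_i\in\Sigma$. Convention: $0^0=1$. *)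

(* Defs.v *)
From mathcomp Require Import all_boot all_order all_algebra all_fingroup.
From mathcomp Require Import all_classical all_reals all_analysis.
From mathcomp Require Import complex.

Set Implicit Arguments.
Unset Strict Implicit.
Unset Printing Implicit Defensive.

Import Order.TTheory GRing.Theory Num.Theory.
Local Open Scope classical_set_scope.
Local Open Scope ring_scope.
Local Open Scope complex_scope.

(* Norms are R-valued (not R[i]-valued), so the scalar modulus is
   [normc : R[i] -> R]. *)
Definition is_norm (R : realType) (d : nat) (N : 'cV[R[i]]_d -> R) : Prop :=
  [/\ forall v, 0 <= N v,
      forall v, N v = 0 -> v = 0,
      forall (a : R[i]) v, N (a *: v) = ComplexField.Normc.normc a * N v &
      forall u v, N (u + v) <= N u + N v].

(* Real suprema: [sup] is the least upper bound only on nonempty bounded sets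
   (it is 0 otherwise); the sets below are nonempty and bounded when 0 < d, N is
   a norm and Sigma is nonempty and bounded. *)
Definition opnorm (R : realType) (d : nat) (N : 'cV[R[i]]_d -> R)
    (A : 'M[R[i]]_d) : R :=
  sup [set N (A *m v) | v in [set v | N v = 1]].

(* [eigenvalue] is stated with row vectors; over a field left and right
   eigenvalues are the same, namely the roots of the characteristic polynomial. *)
Definition spectral_radius (R : realType) (d : nat) (A : 'M[R[i]]_d) : R :=
  sup [set ComplexField.Normc.normc a | a in [set a | eigenvalue A a]].

Definition set_opnorm (R : realType) (d : nat) (N : 'cV[R[i]]_d -> R)
    (Sigma : set 'M[R[i]]_d) : R :=
  sup [set opnorm N A | A in Sigma].

Definition set_spectral_radius (R : realType) (d : nat)
    (Sigma : set 'M[R[i]]_d) : R :=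
  sup [set spectral_radius A | A in Sigma].

Definition set_prod (R : realType) (d : nat) (Sigma : set 'M[R[i]]_d)
    (n : nat) : set 'M[R[i]]_d :=
  [set \prod_(k < n) B k | B in [set B : 'I_n -> 'M[R[i]]_d |
                                  forall k, Sigma (B k)]].

Definition sym_prod (R : realType) (d : nat) (A : 'I_d -> 'M[R[i]]_d) :
    'M[R[i]]_d :=
  \sum_(s : 'S_d) \prod_(k < d) A (s k).

(* Main.v *)
Require Import Defs.
From mathcomp Require Import all_boot all_order all_algebra all_fingroup.
From mathcomp Require Import all_classical all_reals all_analysis.
From mathcomp Require Import complex.
From mathcomp Require Import ring.

(** The symmetrised product [P(A_1, .., A_d)] is the polarisation of [X ^+ d]:
    it is an alternating sum, over [S] included in [{1, .., d}], of the [d]-th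
    powers of the matrices [X_S], where [X_S] is the sum of the [A_i] for [i]
    in [S] ([sum_perm_prod_polarization]).  It is therefore enough to bound
    each [X_S ^+ d], and the Cayley-Hamilton theorem turns this power into a
    combination of the lower powers of [X_S] whose coefficients are those of
    its characteristic polynomial.

    Every one of these coefficients is small as soon as the joint spectral
    data are.  By Newton's identities ([char_poly_newton]) they are
    polynomials without constant term in the traces of the powers of [X_S].
    The trace of [X_S ^+ j] is a sum of at most [d ^ j] traces of words of
    length [j] in the [A_i], and the trace of such a word [w] is at most
    [d * rho(w) <= d * rho(Sigma^j)].  Let [M] be the norm of [Sigma] and [J]
    the maximum of the [rho(Sigma^j)^(1/j)].  As [rho(Sigma^j)^(1/j)] is at
    most [J] and at most [M], one has [rho(Sigma^j) <= J * M^(j-1)]: one factor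
    is estimated by [J] and the others by [M].  Newton's recursion preserves
    estimates of this form: up to constants which depend only on [d], the
    coefficient of [X^(d-k)] is at most [J * M^(k-1)]
    ([char_poly_coef_le]), and the Cayley-Hamilton relation yields a bound
    [J * M^(d-1)] for [X_S ^+ d] ([opnorm_subset_sum_exp_top_le]).

    The constant does not depend on the norm, which enters only through the
    submultiplicativity of [opnorm] and the bound of an eigenvalue by the
    operator norm.  Both require the supremum that defines [opnorm] to be
    finite: this is the equivalence of norms in finite dimension, a
    consequence of the compactness of the unit sphere
    ([norm_rV_equiv_lower]). *)

Set Implicit Arguments.
Unset Strict Implicit.

Import Order.TTheory GRing.Theory Num.Theory.
Local Open Scope ring_scope.

(** * Polarisation *)

(** Expanding the product over [i] of [1 - (i \notin B)] yields the left-hand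
    side, and that product vanishes unless [B] is everything.  The expansion is
    made in [int], where factors commute, and then transported to [R]. *)
Lemma sum_sign_supersets (R : pzRingType) (T : finType) (B : {set T}) :
  \sum_(S : {set T} | B \subset S) (-1) ^+ #|~: S| =
    (B == [set: T]%SET)%:R :> R.
Proof.
suff intE : \sum_(S : {set T} | B \subset S) (-1) ^+ #|~: S| =
    (B == [set: T]%SET)%:R :> int.
  have := congr1 (fun x : int => x%:~R : R) intE.
  rewrite /= rmorph_sum rmorph_nat /= => <-; apply: eq_bigr => S _.
  by rewrite rmorphXn rmorphN1.
pose c i : int := if i \in B then 0 else -1.
transitivity (\prod_i (1 + c i)).
  rewrite bigA_distr [LHS]big_mkcond /=; apply: eq_bigr => S _.
  have [sBS | /fintype.subsetPn[b Bb bNS]] := boolP (B \subset S).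
    rewrite [RHS](bigID (mem S)) /= big1 ?mul1r => [|i -> //].
    rewrite -prodr_const; apply: eq_big => [i | i iNS]; first by rewrite inE.
    rewrite inE in iNS; rewrite (negPf iNS) /c ifN //.
    by apply: contra iNS; apply: (fintype.subsetP sBS).
  by rewrite [RHS](bigD1 b) //= (negPf bNS) /c Bb mul0r.
have [BT | neBT] := eqVneq B [set: T]%SET.
  by rewrite big1 // => i _; rewrite /c BT inE addr0.
have [b bNB] : exists b, b \notin B.
  apply/existsP; rewrite -negb_forall; apply: contra neBT => /forallP BT.
  by apply/eqP/finset.setP=> x; rewrite inE BT.
by rewrite (bigD1 b) //= /c (negPf bNB) subrr mul0r.
Qed.

(** Expanding the powers gives a sum over all maps [f], in which the word
    [A (f 0) .. A (f d.-1)] has for coefficient the sum of the signs of the sets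
    that contain the image of [f]; only surjective maps, that is permutations,
    survive. *)
Lemma sum_perm_prod_polarization (R : pzRingType) (d : nat) (A : 'I_d -> R) :
  \sum_(s : 'S_d) \prod_(k < d) A (s k) =
    \sum_(S : {set 'I_d}) (-1) ^+ #|~: S| * (\sum_(i in S) A i) ^+ d.
Proof.
have imT (f : {ffun 'I_d -> 'I_d}) :
    (f @: 'I_d == [set: 'I_d]%SET) = injectiveb f.
  rewrite eqEcard finset.subsetT cardsT /= -[X in (_ <= X)%N]/(#|f @: 'I_d|).
  apply/idP/injectiveP => [le_d | /card_imset -> //].
  have /imset_injP inj_f : #|f @: 'I_d| == #|'I_d|.
    by rewrite eqn_leq leq_imset_card.
  by move=> x y; apply: inj_f.
transitivity (\sum_(f : {ffun 'I_d -> 'I_d})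
    (f @: 'I_d == [set: 'I_d]%SET)%:R * \prod_(k < d) A (f k)).
  under [RHS]eq_bigr => f _ do rewrite imT.
  rewrite [RHS](bigID (fun f : {ffun 'I_d -> 'I_d} => injectiveb f)) /=.
  rewrite [RHS]addrC [X in _ = X + _]big1 ?add0r; last first.
    by move=> f /negPf->; rewrite mul0r.
  rewrite [RHS](reindex (@pval 'I_d)) /=; last first.
    exists (insubd (1%g : 'S_d)) => [s _ | f]; first exact: valKd.
    by rewrite inE => f_inj; apply: insubdK.
  apply: eq_big => [s | s _]; first by case: s.
  case: s => f f_inj /=; rewrite f_inj mul1r.
  by apply: eq_bigr => k _; rewrite -pvalE.
under eq_bigr => f _ do rewrite -sum_sign_supersets big_distrl /=.
rewrite (exchange_big_dep xpredT) //=; apply: eq_bigr => S _.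
rewrite -big_distrr /=; congr (_ * _).
have -> : (\sum_(i in S) A i) ^+ d = \prod_(k < d) \sum_(i in S) A i.
  by rewrite prodr_const card_ord.
rewrite bigA_distr_big; apply: eq_bigl => f.
apply/fintype.subsetP/ffun_onP => [sfS x | fS _ /imsetP[x _ ->]].
  exact/sfS/imset_f.
exact: fS.
Qed.

(** * Newton's identities and traces *)

Lemma deriv_prod_XsubC (F : comNzRingType) n (z : 'I_n -> F) :
  (\prod_j ('X - (z j)%:P))^`() = \sum_i \prod_(j | j != i) ('X - (z j)%:P).
Proof.
elim: n z => [|n IHn] z; first by rewrite !big_ord0 derivC.
rewrite !big_ord_recl derivM derivXsubC mul1r IHn mulr_sumr; congr (_ + _).
  by rewrite [RHS]big_mkcond big_ord_recl /= mul1r.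
apply: eq_bigr => i _; rewrite [RHS]big_mkcond big_ord_recl /=; congr (_ * _).
by rewrite big_mkcond.
Qed.

(** Here [q`_(n - k)] is, up to sign, the [k]-th elementary symmetric function
    of the [z j].  The derivative of [q] is the sum of the quotients
    [q / ('X - z j)], and synthetic division expresses the coefficients of each
    quotient through powers of [z j] and coefficients of [q]; comparing
    coefficients gives the identities. *)
Lemma newton_identities (F : comNzRingType) n (z : 'I_n -> F)
    (q := \prod_j ('X - (z j)%:P)) (k : nat) : (k <= n)%N ->
  q`_(n - k) *+ k = - \sum_(i < k) (\sum_j z j ^+ i.+1) * q`_(n - k + i.+1).
Proof.
move=> le_kn.
(* The factor 'X shifts the quotient so that the case k = n, which involves the
   remainder of the division, needs no separate treatment. *)
pose r i := 'X * \prod_(j | j != i) ('X - (z j)%:P).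
have qr j : 'X * q = r j * ('X - (z j)%:P).
  by rewrite /q (bigD1 j) //= /r -mulrA [X in _ = _ * X]mulrC.
have r_top j : (r j)`_n.+1 = 0.
  rewrite coefXM /= nth_default // -big_filter size_prod_XsubC -sum1_size.
  rewrite big_filter sum1_card cardC1 card_ord prednK //.
  exact: leq_trans (ltn_ord j).
have r_step j m : (r j)`_m = q`_m + z j * (r j)`_m.+1.
  have /polyP/(_ m.+1) := qr j.
  by rewrite coefXM mulrBr coefB coefMX coefMC /= mulrC => ->; rewrite subrK.
have r_coef j m : (m <= n)%N ->
    (r j)`_(n - m) = \sum_(i < m.+1) z j ^+ i * q`_(n - m + i).
  elim: m => [|m IHm] le_mn.
    by rewrite subn0 r_step r_top mulr0 addr0 big_ord1 mul1r addn0.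
  rewrite r_step big_ord_recl mul1r addn0; congr (_ + _).
  rewrite subnSK // IHm ?mulr_sumr; last exact: ltnW.
  apply: eq_bigr => i _; rewrite mulrA -exprS; congr (_ * q`_ _).
  by rewrite -(subnSK le_mn) /= /bump addSnnS.
have : ('X * q^`())`_(n - k) = q`_(n - k) *+ (n - k).
  by rewrite coefXM; case: (n - k)%N => //= m; rewrite coef_deriv.
rewrite deriv_prod_XsubC mulr_sumr coef_sum -[LHS]/(\sum_j (r j)`_(n - k)).
under eq_bigr => j _ do rewrite r_coef // big_ord_recl expr0 mul1r addn0.
rewrite big_split /= sumr_const card_ord exchange_big /=.
under [X in _ + X]eq_bigr => i _ do rewrite -mulr_suml.
have -> : q`_(n - k) *+ n = q`_(n - k) *+ (n - k) + q`_(n - k) *+ k.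
  by rewrite -mulrnDr subnK.
rewrite -addrA -[RHS]addr0 => /addrI/eqP.
by rewrite addr_eq0 => /eqP.
Qed.

Lemma char_poly_conjmx (F : fieldType) n (P A : 'M[F]_n) : P \in unitmx ->
  char_poly (conjmx P A) = char_poly A.
Proof.
move=> uP; rewrite conjumx // /char_poly /char_poly_mx.
have PK : map_mx polyC P *m map_mx polyC (invmx P) = 1%:M.
  by rewrite -map_mxM mulmxV // map_mx1.
transitivity (\det (map_mx polyC P *m ('X%:M - map_mx polyC A)
                                   *m map_mx polyC (invmx P))).
  by rewrite mulmxBr mulmxBl !map_mxM scalar_mxC -!mulmxA PK mulmx1.
by rewrite !det_mulmx mulrAC -det_mulmx PK det1 mul1r.
Qed.

Lemma trig_mulmx (R : pzRingType) n (A B : 'M[R]_n) :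
  is_trig_mx A -> is_trig_mx B ->
  is_trig_mx (A *m B) /\ forall i, (A *m B) i i = A i i * B i i.
Proof.
move=> /is_trig_mxP tA /is_trig_mxP tB; split.
  apply/is_trig_mxP => i j lt_ij; rewrite mxE big1 // => k _.
  have [lt_ik | le_ki] := ltnP i k; first by rewrite tA ?mul0r.
  by rewrite tB ?mulr0 // (leq_ltn_trans le_ki).
move=> i; rewrite mxE (bigD1 i) //= big1 ?addr0 // => k.
rewrite neq_ltn => /orP[lt_ki | lt_ik]; last by rewrite tA ?mul0r.
by rewrite tB ?mulr0.
Qed.

(** Schur triangularisation: the [z j] are the diagonal entries of a triangular
    matrix similar to [A], hence the eigenvalues with multiplicity. *)
Lemma char_poly_mxtrace_exp (C : numClosedFieldType) n (A : 'M[C]_n) :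
  exists z : 'I_n -> C, char_poly A = \prod_j ('X - (z j)%:P) /\
    forall k, \tr (A ^+ k) = \sum_j z j ^+ k.
Proof.
case: n => [|n] in A *.
  exists (fun=> 0); split=> [|k]; last by rewrite /mxtrace !big_ord0.
  by rewrite big_ord0 /char_poly det_mx00.
have [P /unitarymx_unit uP tT] := Schur A (ltn0Sn n).
set T := conjmx P A in tT.
have {tT} tT : is_trig_mx T by [].
exists (fun j => T j j); split.
  by rewrite -char_poly_trig // char_poly_conjmx.
move=> k; have -> : \tr (A ^+ k) = \tr (T ^+ k).
  have -> : T ^+ k = P *m A ^+ k *m invmx P.
    elim: k => [|k IHk]; first by rewrite !expr0 mulmx1 mulmxV.
    rewrite !exprS IHk /T conjumx // -!mulmxE !mulmxA; congr (_ *m _ *m _).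
    by rewrite -[LHS]mulmxA mulVmx ?mulmx1.
  by rewrite mxtrace_mulC mulmxA mulVmx ?mul1mx.
suff [_ diagE] : is_trig_mx (T ^+ k) /\ forall i, (T ^+ k) i i = T i i ^+ k.
  by apply: eq_bigr => i _.
elim: k => [|k [tTk diagE]].
  by split=> [|i]; rewrite expr0; [exact: scalar_mx_is_trig | rewrite mxE eqxx].
have [] := trig_mulmx tT tTk; rewrite mulmxE -exprS => ? E; split=> // i.
by rewrite E diagE exprS.
Qed.

Lemma char_poly_newton (C : numClosedFieldType) n (X : 'M[C]_n) k :
  (k <= n)%N ->
  (char_poly X)`_(n - k) *+ k =
    - \sum_(i < k) \tr (X ^+ i.+1) * (char_poly X)`_(n - k + i.+1).
Proof.
move=> le_kn; have [z [-> trX]] := char_poly_mxtrace_exp X.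
rewrite newton_identities //; congr (- _).
by apply: eq_bigr => i _; rewrite trX.
Qed.

(** * Norms on finite-dimensional spaces *)

Section FiniteDimensionalNorms.
Local Open Scope classical_set_scope.
Import numFieldNormedType.Exports.

(** [f] is Lipschitz for the maximum norm, so it reaches a minimum on the
    compact unit sphere of that norm, and this minimum is positive; homogeneity
    does the rest. *)
Lemma norm_rV_equiv_lower (R : realType) (n : nat) (f : 'rV[R]_n -> R) :
  (forall a u, f (a *: u) = `|a| * f u) ->
  (forall u w, f (u + w) <= f u + f w) ->
  (forall u, f u = 0 -> u = 0) ->
  exists2 m : R, 0 < m & forall u, m * `|u| <= f u.
Proof.
move=> fZ fD f_eq0.
have f0 : f 0 = 0 by rewrite -(scale0r 0) fZ normr0 mul0r.
have fN u : f (- u) = f u by rewrite -scaleN1r fZ normrN1 mul1r.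
have f_ge0 u : 0 <= f u.
  by have := fD u (- u); rewrite subrr f0 fN -mulr2n pmulrn_lge0.
pose K := \sum_j f (delta_mx 0 j).
have f_le u : f u <= K * `|u|.
  rewrite {1}(row_sum_delta u) mulr_suml.
  have f_sum (I : Type) (s : seq I) (F : I -> 'rV[R]_n) :
      f (\sum_(i <- s) F i) <= \sum_(i <- s) f (F i).
    elim: s => [|i s IHs]; first by rewrite !big_nil f0.
    by rewrite !big_cons (le_trans (fD _ _)) ?lerD2l.
  apply: (le_trans (f_sum _ _ _)); apply: ler_sum => j _; rewrite fZ mulrC.
  rewrite ler_wpM2l // -[leRHS]/(mx_norm u) mx_normrE.
  exact: (le_bigmax _ (fun ij : 'I_1 * 'I_n => `|u ij.1 ij.2|) (0, j)).
have f_cont : continuous f.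
  move=> u; apply/(@cvgrPdist_le _ _ _ (nbhs u)) => e e0.
  have K1 : 0 < K + 1 by rewrite ltr_wpDl // sumr_ge0.
  apply/nbhs_ballP; exists (e / (K + 1)); first exact: divr_gt0.
  move=> w; rewrite -ball_normE /= ltr_pdivlMr // => uw.
  have fuw : f (u - w) <= e.
    rewrite (le_trans (f_le _)) // (le_trans _ (ltW uw)) // mulrC.
    by rewrite ler_wpM2l // lerDl.
  rewrite ler_norml lerNl opprB; apply/andP; split.
    rewrite lerBlDr (le_trans _ (lerD fuw (lexx _))) //.
    rewrite -[X in f X <= _](subrK u).
    by rewrite (le_trans (fD _ _)) // -opprB fN.
  rewrite lerBlDr (le_trans _ (lerD fuw (lexx _))) // -[X in f X <= _](subrK w).
  exact: fD.
(* The sphere is empty when n = 0. *)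
have [S0 | /set0P/negP/negPn/eqP S0] :=
  pselect ([set u : 'rV[R]_n | `|u| = 1] !=set0).
  have cS : compact [set u : 'rV[R]_n | `|u| = 1].
    apply: bounded_closed_compact.
      exists 1; split=> // x x1 u /= ->; exact: ltW.
    apply: (@preimage_closed _ _ (fun u : 'rV[R]_n => `|u|) [set x | x = 1]).
      by move=> u _; exact: norm_continuous.
    exact: closed_eq.
  have [c] := EVT_min_rV S0 cS (continuous_subspaceT f_cont).
  rewrite inE /= => c1 c_min; exists (f c).
    rewrite lt_neqAle f_ge0 andbT eq_sym; apply/eqP => /f_eq0 c0.
    by move: c1; rewrite c0 normr0 => /eqP; rewrite eq_sym oner_eq0.
  move=> u; have [-> | u0] := eqVneq u 0; first by rewrite normr0 mulr0.
  have nu : 0 < `|u| by rewrite normr_gt0.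
  have := c_min (`|u|^-1 *: u).
  rewrite inE /= normrZ normfV normr_id mulVf ?gt_eqF // fZ normfV normr_id.
  by rewrite mulrC ler_pdivlMr //; apply.
exists 1 => // u; rewrite mul1r.
have [-> | u0] := eqVneq u 0; first by rewrite normr0.
have : [set u : 'rV[R]_n | `|u| = 1] (`|u|^-1 *: u).
  by rewrite /= normrZ normfV normr_id mulVf // normr_eq0.
by rewrite S0.
Qed.
End FiniteDimensionalNorms.

Import ComplexField.Normc.

Lemma normc_ge0 (R : rcfType) (x : R[i]) : 0 <= normc x.
Proof. by case: x => a b; apply: sqrtr_ge0. Qed.

Lemma normc_real (R : rcfType) (a : R) : normc (a%:C)%C = `|a|.
Proof. by rewrite /normc /= expr0n addr0 sqrtr_sqr. Qed.

Lemma normc_sum (R : rcfType) (I : Type) (s : seq I) (P : pred I)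
    (F : I -> R[i]) :
  normc (\sum_(i <- s | P i) F i) <= \sum_(i <- s | P i) normc (F i).
Proof.
elim/big_rec2: _ => [|i y x _ le_xy]; first by rewrite normc0.
by rewrite (le_trans (le_normcD _ _)) ?lerD2l.
Qed.

(** * Spectral radius and operator norm *)

(** The supremum that defines the spectral radius is finite because the
    characteristic polynomial has finitely many roots. *)
Lemma eigenvalue_le_spectral_radius (R : realType) d (A : 'M[R[i]]_d) a :
  eigenvalue A a -> normc a <= spectral_radius A.
Proof.
move=> eig; apply: ub_le_sup; last by exists a.
have [z [charA _]] := char_poly_mxtrace_exp A.
exists (\sum_j normc (z j)) => _ [b /= + <-].
rewrite eigenvalue_root_char charA /root horner_prod => /prodf_eq0[j _].
rewrite hornerXsubC subr_eq0 => /eqP->.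
by rewrite (bigD1 j) //= lerDl sumr_ge0 // => k _; exact: normc_ge0.
Qed.

Lemma normc_mxtrace_le (R : realType) d (A : 'M[R[i]]_d) :
  normc (\tr A) <= d%:R * spectral_radius A.
Proof.
have [z [charA trA]] := char_poly_mxtrace_exp A.
have := trA 1; rewrite expr1 => ->.
rewrite (le_trans (normc_sum _ _ _)) // mulr_natl.
rewrite -[X in _ *+ X]card_ord -sumr_const.
apply: ler_sum => j _; rewrite expr1; apply: eigenvalue_le_spectral_radius.
rewrite eigenvalue_root_char charA; apply/rootP.
by rewrite horner_prod (bigD1 j) //= hornerXsubC subrr mul0r.
Qed.

Section OperatorNorm.
Variables (R : realType) (d : nat) (N : 'cV[R[i]]_d -> R).
Hypothesis normN : is_norm N.
Local Notation C := R[i].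
Local Notation "`| A |_op" := (opnorm N A) (format "`| A |_op").

Let N_ge0 v : 0 <= N v. Proof. by case: normN. Qed.
Let N_eq0 v : N v = 0 -> v = 0. Proof. by case: normN => _ + _ _; apply. Qed.
Let NZ (a : C) v : N (a *: v) = normc a * N v. Proof. by case: normN. Qed.
Let ND u v : N (u + v) <= N u + N v. Proof. by case: normN. Qed.
Let N0 : N 0 = 0. Proof. by rewrite -(scale0r 0) NZ normc0 mul0r. Qed.

Let N_sum (I : Type) (s : seq I) (P : pred I) (F : I -> 'cV[C]_d) :
  N (\sum_(i <- s | P i) F i) <= \sum_(i <- s | P i) N (F i).
Proof.
elim/big_rec2: _ => [|i y x _ le_xy]; first by rewrite N0.
by rewrite (le_trans (ND _ _)) ?lerD2l.
Qed.

(** A vector of [C^d] is read as a real vector of length [d + d], real parts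
    followed by imaginary parts, on which [N] is a real norm. *)
Lemma norm_bounds_coordinates :
  exists2 K : R, 0 <= K & forall (v : 'cV[C]_d) j, normc (v j 0) <= K * N v.
Proof.
pose v_ (u : 'rV[R]_(d + d)) : 'cV[C]_d :=
  \col_i Complex (u 0 (lshift d i)) (u 0 (rshift d i)).
have [|||m m_gt0 le_mN] := @norm_rV_equiv_lower R _ (N \o v_).
- move=> a u /=; rewrite -normc_real -NZ; congr N.
  by apply/colP => i; rewrite !mxE; simpc.
- move=> u w /=; have -> : v_ (u + w) = v_ u + v_ w; last exact: ND.
  by apply/colP => i; rewrite !mxE.
- move=> u /= /N_eq0 vu0; apply/rowP => k; rewrite mxE.
  case: (split_ordP k) => j ->; have /colP/(_ j) := vu0; rewrite !mxE;
    by case.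
(* The modulus of a coordinate is at most the sum of two real coordinates, hence
   the factor 2. *)
exists (2 / m) => [|v j]; first by rewrite divr_ge0 // ltW.
pose u := row_mx (\row_i complex.Re (v i 0)) (\row_i complex.Im (v i 0)).
have v_u : v = v_ u.
  apply/colP => i; rewrite mxE row_mxEl row_mxEr !mxE.
  by case: (v i 0).
have coord_le k : `|u 0 k| <= `|u|.
  rewrite -[leRHS]/(mx_norm u) mx_normrE.
  exact: (le_bigmax _ (fun ij : 'I_1 * 'I_(d + d) => `|u ij.1 ij.2|) (0, k)).
have re_im x y : normc (Complex x y) <= `|x| + `|y| :> R.
  have -> : Complex x y = x%:C%C + 'i%C * y%:C%C.
    by rewrite [LHS]complexE.
  rewrite (le_trans (le_normcD _ _)) // normcM !normc_real.
  by rewrite {1}/normc /= expr0n expr1n add0r sqrtr1 mul1r.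
rewrite {1}v_u mxE (le_trans (re_im _ _)) //.
rewrite (le_trans (lerD (coord_le _) (coord_le _))) //.
rewrite -mulr2n -[leLHS]mulr_natl -mulrA ler_pM2l // mulrC ler_pdivlMr // mulrC.
by rewrite [in leRHS]v_u; exact: le_mN.
Qed.

(** The coordinate bound makes the set whose supremum defines [opnorm] bounded, so
    that this supremum is a genuine least upper bound. *)
Lemma le_norm_opnorm A v : N (A *m v) <= `|A|_op * N v.
Proof.
have [K K_ge0 coordK] := norm_bounds_coordinates.
pose B := \sum_i (\sum_j normc (A i j) * K) * N (delta_mx i 0).
have B_ge0 : 0 <= B.
  apply: sumr_ge0 => i _; rewrite mulr_ge0 // sumr_ge0 // => j _.
  by rewrite mulr_ge0 ?normc_ge0.
have leB w : N (A *m w) <= B * N w.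
  have -> : A *m w = \sum_i (A *m w) i 0 *: delta_mx i 0.
    by rewrite [LHS]matrix_sum_delta; apply: eq_bigr => i _; rewrite big_ord1.
  rewrite (le_trans (N_sum _ _ _)) // mulr_suml; apply: ler_sum => i _.
  rewrite NZ mulrAC ler_wpM2r // mxE (le_trans (normc_sum _ _ _)) // mulr_suml.
  by apply: ler_sum => j _; rewrite normcM -mulrA ler_wpM2l ?normc_ge0.
have [-> | v0] := eqVneq v 0; first by rewrite mulmx0 N0 mulr0.
have Nv : 0 < N v.
  by rewrite lt_neqAle N_ge0 andbT eq_sym; apply: contra v0 => /eqP/N_eq0->.
rewrite -ler_pdivrMr //.
pose a : C := ((N v)^-1)%:C%C.
have na : normc a = (N v)^-1 by rewrite normc_real ger0_norm // invr_ge0.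
have -> : N (A *m v) / N v = N (A *m (a *: v)).
  by rewrite -scalemxAr NZ na mulrC.
apply: ub_le_sup; last by exists (a *: v); rewrite //= NZ na mulVf ?gt_eqF.
by exists B => _ [w /= w1 <-]; rewrite (le_trans (leB _)) // w1 mulr1.
Qed.

Lemma opnorm_ge0 A : 0 <= `|A|_op.
Proof.
have [[v v1] | noN] := pselect (exists v, N v = 1).
  rewrite (le_trans (N_ge0 (A *m v))) // (le_trans (le_norm_opnorm _ _)) //.
  by rewrite v1 mulr1.
rewrite /opnorm; set S := (X in sup X).
have -> : S = classical_sets.set0.
  by apply/seteqP; split=> // x [v v1 _]; apply: noN; exists v.
by rewrite sup0.
Qed.

(** The condition [0 <= K] covers the dimension 0, in which no vector has norm 1
    and the supremum is 0 by convention. *)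
Lemma opnorm_le A K :
  0 <= K -> (forall v, N (A *m v) <= K * N v) -> `|A|_op <= K.
Proof.
move=> K_ge0 leK; rewrite /opnorm; set S := (X in sup X).
have [S0 | noS] := pselect (nonempty S).
  apply: ge_sup => // _ [v /= v1 <-].
  by rewrite (le_trans (leK v)) // v1 mulr1.
have -> : S = classical_sets.set0.
  by apply/seteqP; split=> // x Sx; apply: noS; exists x.
by rewrite sup0.
Qed.

Lemma opnormD A B : `|A + B|_op <= `|A|_op + `|B|_op.
Proof.
apply: opnorm_le => [|v]; first by rewrite addr_ge0 ?opnorm_ge0.
by rewrite mulmxDl mulrDl (le_trans (ND _ _)) // lerD ?le_norm_opnorm.
Qed.

Lemma opnormZ (a : C) A : `|a *: A|_op <= normc a * `|A|_op.
Proof.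
apply: opnorm_le => [|v]; first by rewrite mulr_ge0 ?opnorm_ge0 ?normc_ge0.
by rewrite -scalemxAl NZ -mulrA ler_wpM2l ?normc_ge0 ?le_norm_opnorm.
Qed.

Lemma opnormM A B : `|A *m B|_op <= `|A|_op * `|B|_op.
Proof.
apply: opnorm_le => [|v]; first by rewrite mulr_ge0 ?opnorm_ge0.
rewrite -mulmxA -mulrA (le_trans (le_norm_opnorm _ _)) //.
by rewrite ler_wpM2l ?opnorm_ge0 ?le_norm_opnorm.
Qed.

Lemma opnorm1_le1 : `|1%:M|_op <= 1.
Proof. by apply: opnorm_le => // v; rewrite mul1mx mul1r. Qed.

Lemma opnorm_sum (I : Type) (s : seq I) (P : pred I) (F : I -> 'M[C]_d) :
  `|\sum_(i <- s | P i) F i|_op <= \sum_(i <- s | P i) `|F i|_op.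
Proof.
elim/big_rec2: _ => [|i y x _ le_xy].
  by apply: opnorm_le => // v; rewrite mul0mx N0 mul0r.
by rewrite (le_trans (opnormD _ _)) ?lerD2l.
Qed.

Lemma opnorm_prod_le n (B : 'I_n -> 'M[C]_d) (M : R) :
  (forall k, `|B k|_op <= M) -> `|\prod_(k < n) B k|_op <= M ^+ n.
Proof.
elim: n B => [|n IHn] B leM; first by rewrite big_ord0 expr0 opnorm1_le1.
rewrite big_ord_recl exprS (le_trans (opnormM _ _)) //.
by rewrite ler_pM ?opnorm_ge0 // IHn.
Qed.

(** [eigenvalue] speaks of row vectors, [opnorm] of column vectors; [A] and its
    transpose have the same characteristic polynomial. *)
Lemma eigenvalue_le_opnorm A a : eigenvalue A a -> normc a <= `|A|_op.
Proof.
have -> : eigenvalue A a = eigenvalue A^T a.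
  rewrite !eigenvalue_root_char; congr (root _ a).
  rewrite /char_poly -det_tr; congr (\det _).
  by rewrite /char_poly_mx linearB /= tr_scalar_mx map_trmx.
case/eigenvalueP => w wA w0.
have Aw : A *m w^T = a *: w^T.
  by apply: trmx_inj; rewrite trmx_mul trmxK wA linearZ /= trmxK.
have Nw : 0 < N w^T.
  rewrite lt_neqAle N_ge0 andbT eq_sym; apply: contra w0 => /eqP/N_eq0 wT0.
  by rewrite -(trmxK w) wT0 trmx0.
by have := le_norm_opnorm A w^T; rewrite Aw NZ ler_pM2r.
Qed.

Lemma spectral_radius_le_opnorm (A : 'M[C]_d) : spectral_radius A <= `|A|_op.
Proof.
rewrite /spectral_radius; set S := (X in sup X).
have [S0 | noS] := pselect (nonempty S).
  by apply: ge_sup => // _ [b /= eigb <-]; exact: eigenvalue_le_opnorm.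
have -> : S = classical_sets.set0.
  by apply/seteqP; split=> // x Sx; apply: noS; exists x.
by rewrite sup0 opnorm_ge0.
Qed.

End OperatorNorm.

(** * Coefficients of the characteristic polynomial *)

(** Newton's identity writes [k.+1] times the coefficient as a sum of [k.+1]
    products of a trace and an earlier coefficient.  The trace provides the
    factor [J]; for the other factor the weaker estimate with [M] instead of
    [J] suffices, and it also covers the leading coefficient 1, for which there
    is no estimate with [J]. *)
Lemma char_poly_coef_le (R : realType) n (X : 'M[R[i]]_n) (K J M : R) :
  1 <= K -> 0 <= J <= M ->
  (forall i, (i < n)%N -> normc (\tr (X ^+ i.+1)) <= K * J * M ^+ i) ->
  forall k, (k < n)%N ->
    normc (char_poly X)`_(n - k.+1) <= K ^+ k.+1 * J * M ^+ k.
Proof.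
move=> K_ge1 /andP[J_ge0 leJM] trX k lt_kn.
have K_ge0 : 0 <= K by rewrite (le_trans ler01).
have M_ge0 : 0 <= M by rewrite (le_trans J_ge0).
have step m : (m < n)%N ->
    (forall i, (i <= m)%N -> normc (char_poly X)`_(n - i) <= K ^+ i * M ^+ i) ->
    normc (char_poly X)`_(n - m.+1) <= K ^+ m.+1 * J * M ^+ m.
  move=> lt_mn IHm; rewrite -(ler_pMn2r (ltn0Sn m)).
  rewrite -normcMn char_poly_newton // normcN (le_trans (normc_sum _ _ _)) //.
  rewrite -[leRHS]/(_ *+ m.+1) -[X in _ *+ X]card_ord -sumr_const.
  apply: ler_sum => i _; rewrite normcM.
  have le_im : (i <= m)%N by rewrite -ltnS.
  have -> : (n - m.+1 + i.+1 = n - (m - i))%N.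
    by rewrite addnS -addSn subnSK // subnBA // addnBAC // ltnW.
  have lt_in : (i < n)%N := leq_ltn_trans le_im lt_mn.
  rewrite (le_trans (ler_pM _ _ (trX i lt_in) (IHm _ (leq_subr i m)))) //;
    rewrite ?normc_ge0 //.
  have -> : K * J * M ^+ i * (K ^+ (m - i) * M ^+ (m - i)) =
      K ^+ (m - i).+1 * J * M ^+ m.
    have -> : M ^+ m = M ^+ i * M ^+ (m - i) by rewrite -exprD subnKC.
    by rewrite exprS; ring.
  rewrite -!mulrA ler_wpM2r ?mulr_ge0 ?exprn_ge0 // ler_weXn2l //.
  by rewrite ltnS leq_subr.
have small i : (i <= n)%N -> normc (char_poly X)`_(n - i) <= K ^+ i * M ^+ i.
  elim/ltn_ind: i => -[|i] IHi le_in.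
    have /monicP := char_poly_monic X; rewrite /lead_coef size_char_poly /=.
    by rewrite subn0 !expr0 mulr1 => ->; rewrite normc1.
  rewrite (le_trans (step i le_in _)) //.
    by move=> j le_ji; apply: IHi => //; rewrite (leq_trans le_ji) // ltnW.
  rewrite -mulrA [in leRHS](exprS M) ler_wpM2l ?exprn_ge0 //.
  by rewrite ler_wpM2r ?exprn_ge0.
apply: step => // i le_ik; apply: small; exact: leq_trans le_ik (ltnW lt_kn).
Qed.

(** * Words in a family of matrices *)

Section Family.
Variables (R : realType) (n : nat).
Local Notation d := n.+1.
Variables (N : 'cV[R[i]]_d -> R) (A : 'I_d -> 'M[R[i]]_d).
Hypothesis normN : is_norm N.

Let Sigma : set 'M[R[i]]_d := range A.
Let M := set_opnorm N Sigma.
Let rho j := set_spectral_radius (set_prod Sigma j).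
Let J := \big[Num.max/0]_(1 <= j < d.+1) (rho j `^ (j%:R^-1)).

Let subset_sum (S : {set 'I_d}) := \sum_(i in S) A i.

Lemma opnorm_family_le i : opnorm N (A i) <= M.
Proof.
apply: ub_le_sup; last by exists (A i) => //; exists i.
exists (\sum_j opnorm N (A j)) => _ [_ [j _ <-] <-].
by rewrite (bigD1 j) //= lerDl sumr_ge0 // => k _; exact: opnorm_ge0.
Qed.

Lemma set_opnorm_ge0 : 0 <= M.
Proof. exact: le_trans (opnorm_ge0 normN _) (opnorm_family_le ord0). Qed.

Lemma opnorm_subset_sum_exp_le S m :
  opnorm N (subset_sum S ^+ m) <= (d%:R * M) ^+ m.
Proof.
have -> : subset_sum S ^+ m = \prod_(k < m) subset_sum S.
  by rewrite prodr_const card_ord.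
apply: opnorm_prod_le => // _; rewrite (le_trans (opnorm_sum normN _ _ _)) //.
rewrite mulr_natl -[X in _ *+ X]card_ord -sumr_const [leRHS](bigID (mem S)) /=.
rewrite -[leLHS]addr0 lerD ?sumr_ge0 // => [|i _]; last exact: set_opnorm_ge0.
by apply: ler_sum => i _; exact: opnorm_family_le.
Qed.

(** The trace is at most [d] times the spectral radius, and [0 < d]. *)
Lemma spectral_radius_ge0 (B : 'M[R[i]]_d) : 0 <= spectral_radius B.
Proof.
have := le_trans (normc_ge0 _) (normc_mxtrace_le B).
by rewrite pmulr_rge0 // ltr0n.
Qed.

Lemma set_prod_opnorm_le j B : set_prod Sigma j B -> opnorm N B <= M ^+ j.
Proof.
case=> F FS <-; apply: opnorm_prod_le => // k; have [i _ <-] := FS k.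
exact: opnorm_family_le.
Qed.

Lemma spectral_radius_le_set j B :
  set_prod Sigma j B -> spectral_radius B <= rho j.
Proof.
move=> SB; apply: ub_le_sup; last by exists B.
exists (M ^+ j) => _ [B' SB' <-].
exact: le_trans (spectral_radius_le_opnorm normN _) (set_prod_opnorm_le SB').
Qed.

Let word j : set_prod Sigma j (\prod_(k < j) A ord0).
Proof. by exists (fun=> A ord0) => // k; exists ord0. Qed.

Lemma set_spectral_radius_ge0 j : 0 <= rho j.
Proof.
exact: le_trans (spectral_radius_ge0 _) (spectral_radius_le_set (word j)).
Qed.

Lemma set_spectral_radius_le j : rho j <= M ^+ j.
Proof.
set w := \prod_(k < j) A ord0.
apply: ge_sup; first by exists (spectral_radius w), w; first exact: word.
move=> _ [B SB <-].
exact: le_trans (spectral_radius_le_opnorm normN _) (set_prod_opnorm_le SB).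
Qed.

Let root_le j : rho j.+1 `^ (j.+1%:R^-1) <= M.
Proof.
rewrite -(@ler_pXn2r _ j.+1) ?nnegrE ?powR_ge0 ?set_opnorm_ge0 //.
rewrite -powR_mulrn ?powR_ge0 // -powRrM mulVf ?pnatr_eq0 // powRr1.
  exact: set_spectral_radius_le.
exact: set_spectral_radius_ge0.
Qed.

Lemma max_root_ge0 : 0 <= J.
Proof. exact: bigmax_ge_id. Qed.

Lemma max_root_le : J <= M.
Proof.
rewrite /J big_nat; apply: bigmax_le => [|[//|j] _]; last exact: root_le.
exact: set_opnorm_ge0.
Qed.

(** [rho j.+1] is the [j.+1]-st power of its root; one factor is bounded by [J],
    the [j] others by [M]. *)
Lemma set_spectral_radius_le_max_root j : (j < d)%N -> rho j.+1 <= J * M ^+ j.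
Proof.
move=> lt_jd; have rho_ge0 := set_spectral_radius_ge0 j.+1.
have -> : rho j.+1 = (rho j.+1 `^ (j.+1%:R^-1)) ^+ j.+1.
  by rewrite -powR_mulrn ?powR_ge0 // -powRrM mulVf ?pnatr_eq0 // powRr1.
rewrite exprS ler_pM ?exprn_ge0 ?powR_ge0 //; last first.
  by rewrite lerXn2r ?nnegrE ?powR_ge0 ?set_opnorm_ge0 ?root_le.
have j_in : j.+1 \in index_iota 1 d.+1 by rewrite mem_index_iota.
exact: (@Order.TotalTheory.le_bigmax_seq _ _ _ _ 0 j.+1 xpredT
  (fun k => rho k `^ (k%:R^-1)) j_in isT).
Qed.

(** The power expands into at most [d ^ j.+1] words, each of trace at most
    [d * rho j.+1].  The constant [d ^+ d.+1] serves for all [j.+1 <= d]. *)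
Lemma normc_mxtrace_subset_sum_exp_le S j : (j < d)%N ->
  normc (\tr (subset_sum S ^+ j.+1)) <= d%:R ^+ d.+1 * J * M ^+ j.
Proof.
move=> lt_jd.
have -> : subset_sum S ^+ j.+1 = \prod_(k < j.+1) subset_sum S.
  by rewrite prodr_const card_ord.
rewrite bigA_distr_big raddf_sum (le_trans (normc_sum _ _ _)) //.
have rJM := set_spectral_radius_le_max_root lt_jd.
have JM_ge0 : 0 <= J * M ^+ j.
  by rewrite mulr_ge0 ?max_root_ge0 ?exprn_ge0 ?set_opnorm_ge0.
apply: (@le_trans _ _ (\sum_(f : {ffun 'I_j.+1 -> 'I_d}) d%:R * (J * M ^+ j))).
  rewrite [leRHS](bigID (fun f => f \in ffun_on (mem S))) /=.
  rewrite -[leLHS]addr0 lerD ?sumr_ge0 // => [|f _]; last by rewrite mulr_ge0.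
  apply: ler_sum => f _; rewrite (le_trans (normc_mxtrace_le _)) //.
  rewrite ler_wpM2l ?(le_trans _ rJM) // spectral_radius_le_set //.
  by exists (fun k => A (f k)) => // k; exists (f k).
rewrite sumr_const card_ffun !card_ord -[leLHS]mulr_natl natrX mulrA -exprSr.
by rewrite -mulrA ler_wpM2r // ler_weXn2l // ler1n.
Qed.

(** Cayley-Hamilton.  The leading coefficient being 1, only the lower powers of
    the matrix remain, and each of their coefficients carries a factor [J]. *)
Lemma opnorm_subset_sum_exp_top_le S :
  opnorm N (subset_sum S ^+ d) <=
    d%:R * (d%:R ^+ d.+1) ^+ d * (J * M ^+ n).
Proof.
set X := subset_sum S; set K : R := d%:R ^+ d.+1.
have d_ge1 : 1 <= d%:R :> R by rewrite ler1n.
have K_ge1 : 1 <= K by rewrite exprn_ege1.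
have XE : X ^+ d = - \sum_(i < d) (char_poly X)`_i *: X ^+ i.
  have charX_d : (char_poly X)`_d = 1.
    by have /monicP := char_poly_monic X; rewrite /lead_coef size_char_poly.
  apply/eqP; rewrite eq_sym -subr_eq0 -opprD oppr_eq0; apply/eqP.
  rewrite -[RHS](Cayley_Hamilton X) -[in RHS](coefK (char_poly X)) poly_def.
  rewrite size_char_poly [in RHS]big_ord_recr /= charX_d scale1r.
  rewrite rmorphD rmorph_sum /=.
  rewrite rmorphXn /= horner_mx_X; congr (_ + _).
  by apply: eq_bigr => i _; rewrite horner_mxZ rmorphXn /= horner_mx_X.
rewrite XE -scaleN1r (le_trans (opnormZ normN _ _)) // normcN normc1 mul1r.
rewrite (le_trans (opnorm_sum normN _ _ _)) // -mulrA mulr_natl.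
rewrite -[X in _ *+ X]card_ord -sumr_const; apply: ler_sum => i _.
rewrite (le_trans (opnormZ normN _ _)) //.
have le_in : (i <= n)%N by rewrite -ltnS.
have JleM : 0 <= J <= M by rewrite max_root_ge0 max_root_le.
have lt_nid : (n - i < d)%N by rewrite ltnS leq_subr.
have := char_poly_coef_le K_ge1 JleM
  (@normc_mxtrace_subset_sum_exp_le S) lt_nid.
have -> : (d - (n - i).+1 = i)%N by rewrite subSS subKn.
move=> coef_le; have M_ge0 := set_opnorm_ge0; have J_ge0 := max_root_ge0.
have K_ge0 : 0 <= K := le_trans ler01 K_ge1.
have := opnorm_subset_sum_exp_le S i => exp_le.
rewrite (le_trans (ler_pM _ _ coef_le exp_le)) ?normc_ge0 ?opnorm_ge0 //.
rewrite [(d%:R * M) ^+ i]exprMn.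
have -> : K ^+ (n - i).+1 * J * M ^+ (n - i) * (d%:R ^+ i * M ^+ i) =
    K ^+ (n - i).+1 * d%:R ^+ i * (J * M ^+ n).
  have -> : M ^+ n = M ^+ (n - i) * M ^+ i by rewrite -exprD subnK.
  by ring.
rewrite ler_wpM2r ?mulr_ge0 ?exprn_ge0 //.
have -> : K ^+ d = K ^+ (n - i).+1 * K ^+ i by rewrite -exprD addSn subnK.
rewrite ler_wpM2l ?exprn_ge0 // lerXn2r ?nnegrE //.
by rewrite -[leLHS]expr1 ler_weXn2l.
Qed.

End Family.

(** * The bound for the symmetrised product *)

Unset Implicit Arguments.
Local Open Scope classical_set_scope.
Local Open Scope complex_scope.

Theorem proposition12 (R : realType) (d : nat) (hd : (1 <= d)%N) :
  exists C : R, 1 < C /\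
    forall N : 'cV[R[i]]_d -> R, is_norm N ->
    forall A : 'I_d -> 'M[R[i]]_d,
      let Sigma : set 'M[R[i]]_d := range A in
      opnorm N (sym_prod A) <=
        C * set_opnorm N Sigma ^+ d.-1 *
        \big[Num.max/0]_(1 <= j < d.+1)
          (set_spectral_radius (set_prod Sigma j) `^ (j%:R^-1)).
Proof.
case: d hd => // n _; set K : R := n.+1%:R * (n.+1%:R ^+ n.+2) ^+ n.+1.
have K_ge0 : 0 <= 2 ^+ n.+1 * K by rewrite !mulr_ge0 ?exprn_ge0.
(* There are 2 ^ d sets S, each contributing at most K * J * M ^+ d.-1; adding 1
   keeps the constant above 1 and costs nothing. *)
exists (2 ^+ n.+1 * K + 1); split.
  by rewrite ltrDr mulr_gt0 ?exprn_gt0 // mulr_gt0 ?exprn_gt0.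
move=> N normN A; cbv zeta; set M := set_opnorm _ _.
set J := \big[_/_]_(_ <= _ < _) _.
have M_ge0 : 0 <= M := set_opnorm_ge0 A normN.
have J_ge0 : 0 <= J := max_root_ge0 A.
rewrite /sym_prod sum_perm_prod_polarization.
rewrite (le_trans (opnorm_sum normN _ _ _)) //.
apply: (@le_trans _ _ (\sum_(S : {set 'I_n.+1}) K * (J * M ^+ n))).
  apply: ler_sum => S _.
  rewrite (le_trans _ (opnorm_subset_sum_exp_top_le A normN S)) //.
  rewrite -signr_odd mulr_sign; case: ifP => // _; rewrite -scaleN1r.
  by rewrite (le_trans (opnormZ normN _ _)) // normcN normc1 mul1r.
rewrite sumr_const -cardsT -powersetT card_powerset cardsT card_ord.
rewrite -[leLHS]mulr_natl natrX mulrA -[leRHS]mulrA [X in _ <= _ * X]mulrC.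
by rewrite ler_wpM2r ?mulr_ge0 ?exprn_ge0 // lerDl.
Qed.
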